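(* Let $\mathbb{G}$ be a finite quantum group, let $\mathsf{B}$ be a commutative unital $\mathrm{C}^*$-algebra, $\mathsf{B}=\mathrm{C}(X)$ with $X$ a compact (Hausdorff) space, and let $\alpha\colon\mathrm{C}(\mathbb{G})\to\mathrm{C}(\mathbb{G})\otimes\mathsf{B}$ represent a quantum family of automorphisms of $\mathbb{G}$. Then there is a family $\{\psi_x\}_{x\in X}$ of Hopf $*$-algebra automorphisms of $\mathrm{C}(\mathbb{G})$ such that for any $x\in X$ and $a\in\mathrm{C}(\mathbb{G})$ $$(\mathrm{id}\otimes\xi_x)\alpha(a)=\psi_x(a),$$ where $\xi_x\colon\mathsf{B}\ni f\mapsto f(x)\in\mathbb{C}$ is the evaluation map. Moreover, for fixed $a\in\mathrm{C}(\mathbb{G})$ the elements $\psi_x(a)$ depend continuously on $x$. If, in addition, $\mathbb{G}$ is a classical finite group (i.e. $\mathrm{C}(\mathbb{G})$ is the algebra of functions on a finite group), then each $\psi_x$ is (induced by) an automorphism of the group $\mathbb{G}$.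
   Context: Finite quantum group: $\mathbb{G}$ is given by a finite-dimensional $\mathrm{C}^*$-algebra $\mathrm{C}(\mathbb{G})$ which is a Hopf $*$-algebra with coproduct $\Delta$, antipode $S$, counit $\epsilon$ and Haar state $h$ (the unique bi-invariant state; it is a faithful trace, and $S$ is involutive and commutes with $*$). Convolution product: $a\star b=(h\otimes\mathrm{id})\bigl(((S\otimes\mathrm{id})\Delta(b))(a\otimes\mathbb{1})\bigr)$; convolution adjoint: $a^\bullet=S(a^* )$; Haar element: the unique $\eta\in\mathrm{C}(\mathbb{G})$ with $\epsilon(\eta)=1$, $a\eta=\epsilon(a)\eta$ for all $a$. For a unital $\mathrm{C}^*$-algebra $\mathsf{B}$, a linear map $\alpha\colon\mathrm{C}(\mathbb{G})\to\mathrm{C}(\mathbb{G})\otimes\mathsf{B}$ represents a quantum family of automorphisms of $\mathbb{G}$ if it is a unital $*$-homomorphism, satisfies the Podleś condition ($\alpha(\mathrm{C}(\mathbb{G}))(\mathbb{1}\otimes\mathsf{B})$ spans $\mathrm{C}(\mathbb{G})\otimes\mathsf{B}$), preserves the convolution product (is a homomorphism from $(\mathrm{C}(\mathbb{G}),\star)$ to $\mathrm{C}(\mathbb{G})\otimes\mathsf{B}$ with product $(a\otimes b)(a'\otimes b')=(a\star a')\otimes bb'$), preserves the convolution adjoint ($(\bullet\otimes * )\circ\alpha=\alpha\circ\bullet$) and the Haar element ($\alpha(\eta)=\eta\otimes\mathbb{1}_{\mathsf{B}}$). *)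

(* Defs.v *)
From HB Require Import structures.
From mathcomp Require Import all_boot all_order all_fingroup all_algebra all_field.
From mathcomp Require Export complex.
From mathcomp Require Import all_classical all_reals all_analysis.

Set Implicit Arguments.
Unset Strict Implicit.
Unset Printing Implicit Defensive.

Import Order.TTheory GRing.Theory Num.Theory.
Import numFieldNormedType.Exports.

Local Open Scope classical_set_scope.
Local Open Scope ring_scope.

(* Algebraic tensor product of a finite-dimensional space V with a space W:   *)
(* the family t stands for \sum_i e_i (x) t_i, where e is the basis vbasis of *)
(* V. The lemmas tens_ind, tliftE and tlift_uniq below give the universal     *)
(* property, so that nothing depends on the choice of the basis.              *)
Notation tens V W := ({ffun 'I_(\dim (fullv : {vspace V})) -> W}).

Section Tensor.
Variable K : fieldType.

Definition tbase (V : vectType K) (i : 'I_(\dim (fullv : {vspace V}))) : V :=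
  (vbasis fullv)`_i.

Definition ptens (V : vectType K) (W : lmodType K) (v : V) (w : W) :
  tens V W := [ffun i => coord (vbasis fullv) i v *: w].

Definition tlift (V : vectType K) (W : lmodType K) (U : nmodType)
    (b : V -> W -> U) (t : tens V W) : U := \sum_i b (tbase i) (t i).

Definition tmap (V V' : vectType K) (W W' : lmodType K)
    (f : V -> V') (g : W -> W') : tens V W -> tens V' W' :=
  tlift (fun v w => ptens (f v) (g w)).

Definition tmul (V : vectType K) (W : lmodType K)
    (m : V -> V -> V) (n : W -> W -> W) (s t : tens V W) : tens V W :=
  tlift (fun v w => tlift (fun v' w' => ptens (m v v') (n w w')) t) s.

Definition tassoc (U V : vectType K) (W : lmodType K) :
    tens (tens U V) W -> tens U (tens V W) :=
  tlift (fun t w => tlift (fun u v => ptens u (ptens v w)) t).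

(* (phi (x) id)(t) and (id (x) phi)(t), under C (x) W = W and V (x) C = V. *)
Definition slicel (V : vectType K) (W : lmodType K) (phi : V -> K) :
  tens V W -> W := tlift (fun v w => phi v *: w).

Definition slicer (V : vectType K) (W : lmodType K) (phi : W -> K) :
  tens V W -> V := tlift (fun v w => phi w *: v).

Section Universal.
Variables (V : vectType K) (W : lmodType K).

Lemma ptensDl (v v' : V) (w : W) : ptens (v + v') w = ptens v w + ptens v' w.
Proof. by apply/ffunP => i; rewrite !ffunE linearD scalerDl. Qed.

Lemma ptensDr (v : V) (w w' : W) : ptens v (w + w') = ptens v w + ptens v w'.
Proof. by apply/ffunP => i; rewrite !ffunE scalerDr. Qed.

Lemma ptensZl k (v : V) (w : W) : ptens (k *: v) w = k *: ptens v w.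
Proof. by apply/ffunP => i; rewrite !ffunE linearZ scalerA. Qed.

Lemma ptensZr k (v : V) (w : W) : ptens v (k *: w) = k *: ptens v w.
Proof. by apply/ffunP => i; rewrite !ffunE !scalerA mulrC. Qed.

Lemma tbase_decomp (v : V) :
  v = \sum_i coord (vbasis fullv) i v *: tbase i.
Proof. exact: coord_vbasis (memvf v). Qed.

Lemma coord_tbase i j : coord (vbasis fullv) i (@tbase V j) = (i == j)%:R.
Proof. by rewrite coord_free ?(basis_free (vbasisP _)) // eq_sym. Qed.

Lemma tens_ind (t : tens V W) : t = \sum_i ptens (tbase i) (t i).
Proof.
apply/ffunP => i; rewrite sum_ffunE (bigD1 i) //= big1 => [|j ji].
  by rewrite ffunE coord_tbase eqxx scale1r addr0.
by rewrite ffunE coord_tbase eq_sym (negPf ji) scale0r.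
Qed.

(* The hypotheses hold when b is bilinear and also when b is conjugate-linear *)
(* in both variables, as for the involution on a tensor product.              *)
Lemma tliftE (U : nmodType) (b : V -> W -> U) (v : V) (w : W) :
  (forall u, {morph b^~ u : x y / x + y}) -> (forall x, b 0 x = 0) ->
  (forall k x y, b x (k *: y) = b (k *: x) y) ->
  tlift b (ptens v w) = b v w.
Proof.
move=> bD b0 bZ; rewrite /tlift {2}(tbase_decomp v).
rewrite (big_morph (b^~ w) (bD w) (b0 w)).
by apply: eq_bigr => i _; rewrite ffunE bZ.
Qed.

Lemma tlift_uniq (U : nmodType) (b : V -> W -> U) (F : tens V W -> U) :
  {morph F : x y / x + y} -> F 0 = 0 ->
  (forall v w, F (ptens v w) = b v w) -> F =1 tlift b.
Proof.
move=> FD F0 Fb t; rewrite {1}(tens_ind t) (big_morph F FD F0).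
by apply: eq_bigr => i _; rewrite Fb.
Qed.

End Universal.

Lemma tmapE (V V' : vectType K) (W W' : lmodType K)
    (f : {linear V -> V'}) (g : {linear W -> W'}) v w :
  tmap f g (ptens v w) = ptens (f v) (g w).
Proof.
apply: tliftE => [u x y|x|k x y]; first by rewrite linearD ptensDl.
- by rewrite linear0 -(scale0r (0 : V')) ptensZl scale0r.
- by rewrite !linearZ ptensZl ptensZr.
Qed.

Lemma tmulE (V : vectType K) (W : lmodType K)
    (m : V -> V -> V) (n : W -> W -> W) v v' w w' :
  left_distributive m +%R -> right_distributive m +%R ->
  (forall k x y, m (k *: x) y = k *: m x y) ->
  (forall k x y, m x (k *: y) = k *: m x y) ->
  (forall k x y, n (k *: x) y = k *: n x y) ->
  (forall k x y, n x (k *: y) = k *: n x y) ->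
  tmul m n (ptens v w) (ptens v' w') = ptens (m v v') (n w w').
Proof.
move=> mDl mDr mZl mZr nZl nZr.
have ptens0 u : ptens 0 u = 0 :> tens V W.
  by rewrite -(scale0r (0 : V)) ptensZl scale0r.
rewrite /tmul tliftE.
- apply: tliftE => [u x y|x|k x y]; first by rewrite mDr ptensDl.
  + by rewrite -(scale0r (0 : V)) mZr scale0r ptens0.
  + by rewrite mZr nZr ptensZl ptensZr.
- move=> u x y; rewrite /tlift -big_split /=; apply: eq_bigr => i _.
  by rewrite mDl ptensDl.
- move=> u; rewrite /tlift big1 // => i _.
  by rewrite -(scale0r (0 : V)) mZl scale0r ptens0.
- move=> k x y; rewrite /tlift; apply: eq_bigr => i _.
  by rewrite mZl nZl ptensZl ptensZr.
Qed.

End Tensor.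

(* Unital *-algebras, possibly zero (C(X) is zero when X is empty), which is  *)
(* why the product is not that of a MathComp algType.                         *)
Record starAlgebra (K : numClosedFieldType) := StarAlgebra {
  sa_space :> lmodType K;
  samul : sa_space -> sa_space -> sa_space;
  saone : sa_space;
  sastar : sa_space -> sa_space;
  samulA : associative samul;
  samul1 : left_id saone samul;
  samulr1 : right_id saone samul;
  samulDl : left_distributive samul +%R;
  samulDr : right_distributive samul +%R;
  samulZl : forall (k : K) b c, samul (k *: b) c = k *: samul b c;
  samulZr : forall (k : K) b c, samul b (k *: c) = k *: samul b c;
  sastarD : {morph sastar : b c / b + c};
  sastarZ : forall (k : K) b, sastar (k *: b) = Num.conj k *: sastar b;
  sastarM : forall b c, sastar (samul b c) = samul (sastar c) (sastar b);
  sastarK : involutive sastar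
}.

(* The algebra C(X) of continuous K-valued functions, with pointwise          *)
(* operations.                                                                *)
Section ContinuousFunctions.
Variables (X : topologicalType) (K : numClosedFieldType).
Implicit Types f g : continuousType X K.

Let ctsF f : continuous (f : X -> K). Proof. exact: cts_fun. Qed.

Lemma ccstP (k : K) : continuous (fun _ : X => k).
Proof. by move=> x; exact: cvg_cst. Qed.
Lemma coppP f : continuous (fun x => - f x).
Proof. by move=> x; apply: cvgN; exact: ctsF. Qed.
Lemma caddP f g : continuous (fun x => f x + g x).
Proof. by move=> x; apply: cvgD; exact: ctsF. Qed.
Lemma cmulP f g : continuous (fun x => f x * g x).
Proof. by move=> x; apply: cvgM; exact: ctsF. Qed.
Lemma cscaleP (k : K) f : continuous (fun x => k * f x).
Proof. by move=> x; apply: cvgM; [exact: cvg_cst|exact: ctsF]. Qed.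
Lemma cconjP f : continuous (fun x => Num.conj (f x)).
Proof.
move=> x; apply/cvgrPdist_lt => e e0.
have /cvgrPdist_lt/(_ e e0) := @ctsF f x.
by apply: filterS => y; rewrite -rmorphB norm_conjC.
Qed.

Definition ccst k : continuousType X K := mkcts (@ccstP k).
Definition copp f : continuousType X K := mkcts (@coppP f).
Definition cadd f g : continuousType X K := mkcts (@caddP f g).
Definition cmul f g : continuousType X K := mkcts (@cmulP f g).
Definition cscale k f : continuousType X K := mkcts (@cscaleP k f).
Definition cconj f : continuousType X K := mkcts (@cconjP f).

Let caddA : associative cadd.
Proof. by move=> f g h; apply/continuousEP => x; exact: addrA. Qed.
Let caddC : commutative cadd.
Proof. by move=> f g; apply/continuousEP => x; exact: addrC. Qed.
Let cadd0 : left_id (ccst 0) cadd.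
Proof. by move=> f; apply/continuousEP => x; exact: add0r. Qed.
Let caddN : left_inverse (ccst 0) copp cadd.
Proof. by move=> f; apply/continuousEP => x; exact: addNr. Qed.

HB.instance Definition _ := GRing.isZmodule.Build (continuousType X K)
  caddA caddC cadd0 caddN.

Let cscaleA k l f : cscale k (cscale l f) = cscale (k * l) f.
Proof. by apply/continuousEP => x; exact: mulrA. Qed.
Let cscale1 : left_id 1 cscale.
Proof. by move=> f; apply/continuousEP => x; exact: mul1r. Qed.
Let cscaleDr : right_distributive cscale +%R.
Proof. by move=> k f g; apply/continuousEP => x; exact: mulrDr. Qed.
Let cscaleDl f : {morph cscale^~ f : k l / k + l}.
Proof. by move=> k l; apply/continuousEP => x; exact: mulrDl. Qed.

HB.instance Definition _ := GRing.Zmodule_isLmodule.Build K (continuousType X K)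
  cscaleA cscale1 cscaleDr cscaleDl.

Definition contAlgebra : starAlgebra K.
Proof.
refine (@StarAlgebra K (continuousType X K) cmul (ccst 1) cconj
  _ _ _ _ _ _ _ _ _ _ _).
- by move=> f g h; apply/continuousEP => x; exact: mulrA.
- by move=> f; apply/continuousEP => x; exact: mul1r.
- by move=> f; apply/continuousEP => x; exact: mulr1.
- by move=> f g h; apply/continuousEP => x; exact: mulrDl.
- by move=> f g h; apply/continuousEP => x; exact: mulrDr.
- by move=> k f g; apply/continuousEP => x; rewrite /= /mkcts /= mulrA.
- by move=> k f g; apply/continuousEP => x; exact: mulrCA.
- by move=> f g; apply/continuousEP => x; exact: rmorphD.
- by move=> k f; apply/continuousEP => x; exact: rmorphM.
- by move=> f g; apply/continuousEP => x; rewrite /= /mkcts rmorphM mulrC.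
- by move=> f; apply/continuousEP => x; exact: conjCK.
Defined.

Definition evalAt (x : X) (f : contAlgebra) : K := (f : continuousType X K) x.

End ContinuousFunctions.

(* Finite-dimensional unital C*-algebras. As for all MathComp norms, the norm *)
(* takes its (real, nonnegative) values in K; no completeness axiom is needed *)
(* in finite dimension over K = R[i].                                         *)
Record finCstarAlgebra (K : numClosedFieldType) := FinCstarAlgebra {
  fc_alg :> falgType K;
  star : fc_alg -> fc_alg;
  cnorm : fc_alg -> K;
  starD : {morph star : a b / a + b};
  starZ : forall (k : K) a, star (k *: a) = Num.conj k *: star a;
  starM : forall a b, star (a * b) = star b * star a;
  starK : involutive star;
  cnorm_ge0 : forall a, 0 <= cnorm a;
  cnorm0_eq0 : forall a, cnorm a = 0 -> a = 0;
  cnormD : forall a b, cnorm (a + b) <= cnorm a + cnorm b;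
  cnormZ : forall (k : K) a, cnorm (k *: a) = `|k| * cnorm a;
  cnormM : forall a b, cnorm (a * b) <= cnorm a * cnorm b;
  cnorm_star : forall a, cnorm (star a * a) = cnorm a ^+ 2
}.

(* Only the defining properties of the Haar state and of the Haar element are *)
(* recorded: their uniqueness, the faithfulness and traciality of the Haar    *)
(* state, and the facts that the antipode is involutive and commutes with the *)
(* involution, are consequences.                                              *)
Record finQuantumGroup (K : numClosedFieldType) := FinQuantumGroup {
  Cof :> finCstarAlgebra K;
  Delta : {linear Cof -> tens Cof Cof};
  counit : {linear Cof -> K^o};
  antipode : {linear Cof -> Cof};
  haar : {linear Cof -> K^o};
  haarElt : Cof;
  Delta1 : Delta 1 = ptens 1 1;
  DeltaM : forall a b : Cof, Delta (a * b) = tmul *%R *%R (Delta a) (Delta b);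
  Delta_star : forall a : Cof,
    Delta (star a) = tmap (@star _ Cof) (@star _ Cof) (Delta a);
  Delta_coassoc : forall a : Cof,
    tassoc (tmap Delta id (Delta a)) = tmap id Delta (Delta a);
  counit1 : counit 1 = 1;
  counitM : forall a b : Cof, counit (a * b) = counit a * counit b;
  counitl : forall a : Cof, slicel counit (Delta a) = a;
  counitr : forall a : Cof, slicer counit (Delta a) = a;
  antipodel : forall a : Cof,
    tlift *%R (tmap antipode id (Delta a)) = (counit a)%:A;
  antipoder : forall a : Cof,
    tlift *%R (tmap id antipode (Delta a)) = (counit a)%:A;
  haar1 : haar 1 = 1;
  haar_ge0 : forall a : Cof, 0 <= haar (star a * a);
  haarl : forall a : Cof, slicel haar (Delta a) = (haar a)%:A;
  haarr : forall a : Cof, slicer haar (Delta a) = (haar a)%:A;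
  counit_haarElt : counit haarElt = 1;
  mul_haarElt : forall a : Cof, a * haarElt = counit a *: haarElt
}.

Arguments Delta {K G} : rename.
Arguments counit {K G} : rename.
Arguments antipode {K G} : rename.
Arguments haar {K G} : rename.
Arguments haarElt {K} G : rename.

Section QuantumGroup.
Variables (K : numClosedFieldType) (G : finQuantumGroup K).

(* a * b = (h (x) id)(((S (x) id) Delta(b)) (a (x) 1)) *)
Definition convolution (a b : G) : G :=
  slicel haar
    (tmul *%R *%R (tmap antipode id (Delta b)) (ptens a 1)).

Definition bullet (a : G) : G := antipode (star a).

Section Family.
Variables (B : starAlgebra K) (alpha : {linear G -> tens G B}).

Record unital_star_hom : Prop := UnitalStarHom {
  ush1 : alpha 1 = ptens 1 (saone B);
  ushM : forall a b, alpha (a * b) = tmul *%R (@samul K B) (alpha a) (alpha b);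
  ush_star : forall a, alpha (star a) = tmap (@star K G) (@sastar K B) (alpha a)
}.

Definition podles : Prop := forall t : tens G B, exists s : seq (G * B),
  t = \sum_(p <- s) tmul *%R (@samul K B) (alpha p.1) (ptens 1 p.2).

Record quantum_family_of_automorphisms : Prop := QuantumFamily {
  qf_hom : unital_star_hom;
  qf_podles : podles;
  qf_conv : forall a b,
    alpha (convolution a b) = tmul convolution (@samul K B) (alpha a) (alpha b);
  qf_bullet : forall a, tmap bullet (@sastar K B) (alpha a) = alpha (bullet a);
  qf_haarElt : alpha (haarElt G) = ptens (haarElt G) (saone B)
}.

End Family.

Record hopf_star_automorphism (psi : G -> G) : Prop := HopfStarAutomorphism {
  ha_linear : linear psi;
  ha_bij : bijective psi;
  ha1 : psi 1 = 1;
  haM : {morph psi : a b / a * b};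
  ha_star : {morph psi : a / star a};
  ha_Delta : forall a, Delta (psi a) = tmap psi psi (Delta a);
  ha_counit : forall a, counit (psi a) = counit a;
  ha_antipode : forall a, antipode (psi a) = psi (antipode a)
}.

Definition cnorm_continuous (X : topologicalType) (f : X -> G) : Prop :=
  forall x0 : X, cnorm (f x - f x0) @[x --> x0] --> (0 : K).

(* theta is an isomorphism of Hopf *-algebras from C(G) to the algebra of all *)
(* functions on the finite group gT; the coproduct, counit and antipode of    *)
(* the latter are f |-> ((s, t) |-> f (s * t)), f |-> f 1 and                 *)
(* f |-> (s |-> f s^-1).                                                      *)
Record function_algebra_iso (gT : finGroupType)
    (theta : G -> {ffun gT -> K}) : Prop := FunctionAlgebraIso {
  fa_linear : forall (k : K) a b s,
    theta (k *: a + b) s = k * theta a s + theta b s;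
  fa_bij : bijective theta;
  fa1 : forall s, theta 1 s = 1;
  faM : forall a b s, theta (a * b) s = theta a s * theta b s;
  fa_star : forall a s, theta (star a) s = Num.conj (theta a s);
  fa_Delta : forall a s t,
    tlift (fun b c => theta b s * theta c t) (Delta a) = theta a (s * t)%g;
  fa_counit : forall a, counit a = theta a 1%g;
  fa_antipode : forall a s, theta (antipode a) s = theta a s^-1%g
}.

End QuantumGroup.

(* Main.v *)
Require Import Defs.
From HB Require Import structures.
Set Warnings "-all".
From mathcomp Require Import all_boot all_order all_fingroup all_algebra all_field.
From mathcomp Require Import complex.
From mathcomp Require Import all_classical all_reals all_analysis.
Import Order.TTheory GRing.Theory Num.Theory.
Import numFieldNormedType.Exports.
Local Open Scope ring_scope.

(* The slice psi_x = (id (x) ev_x) alpha is a unital *-homomorphism compatible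
   with convolution; it is onto by the Podles condition, hence bijective.
   Since a * 1 = h(a) 1 for the convolution and a eta = eps(a) eta, it preserves
   h and eps, and it commutes with S because it commutes with * and bullet.
   As a * b = h(S(b_1) a) b_2 for the convolution, applying psi_x gives
   h(S(u) c) v = h(S(u') c) v' for all c, where u (x) v = Delta(psi_x(b)) and
   u' (x) v' = (psi_x (x) psi_x)(Delta(b)). As S is injective and the form h(ac)
   is nondegenerate, Delta is preserved.
   Both facts follow from h(eta) a = S(h(a eta_1) eta_2), once h(eta) <> 0.
   For a classical group, the functional a |-> psi_x(a)(s) is a character of the
   algebra of functions, that is, an evaluation. *)

Set Implicit Arguments.
Unset Strict Implicit.

(** * Calculus of bilinear maps lifted to tensor products *)

Section TensorCalculus.
Variable K : fieldType.

(** A predicate rather than a bundled structure, so that it applies directly to the anonymous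
    functions under [tlift]. *)
Definition bilinear_map (V W U : lmodType K) (b : V -> W -> U) : Prop :=
  (forall w, linear (b^~ w)) /\ (forall v, linear (b v)).

Definition trilinear_map (V1 V2 V3 U : lmodType K) (f : V1 -> V2 -> V3 -> U) :
    Prop :=
  [/\ forall v w, linear (fun u => f u v w),
      forall u w, linear (fun v => f u v w) &
      forall u v, linear (fun w => f u v w)].

Lemma linear_fun0 (V U : lmodType K) (f : V -> U) : linear f -> f 0 = 0.
Proof. by move=> fl; have := fl (-1) 0 0; rewrite !scaleN1r !addNr. Qed.

Lemma linear_funD (V U : lmodType K) (f : V -> U) :
  linear f -> {morph f : x y / x + y}.
Proof. by move=> fl x y; have := fl 1 x y; rewrite !scale1r. Qed.

Lemma linear_funZ (V U : lmodType K) (f : V -> U) k x :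
  linear f -> f (k *: x) = k *: f x.
Proof. by move=> fl; have := fl k x 0; rewrite (linear_fun0 fl) !addr0. Qed.

Lemma linear_fun_sum (V U : lmodType K) (f : V -> U) (I : finType)
    (F : I -> V) :
  linear f -> f (\sum_i F i) = \sum_i f (F i).
Proof.
by move=> fl; apply: big_morph; [apply: linear_funD|apply: linear_fun0].
Qed.

Section Lift.
Variables (V : vectType K) (W U : lmodType K).
Implicit Types (b : V -> W -> U) (t : tens V W).

Lemma tlift_linear b : (forall v, linear (b v)) -> linear (tlift b).
Proof.
move=> bl k s t; rewrite /tlift scaler_sumr -big_split /=.
by apply: eq_bigr => i _; rewrite !ffunE bl.
Qed.

Lemma tlift_ptens b v w : bilinear_map b -> tlift b (ptens v w) = b v w.
Proof.
move=> [bl br]; apply: tliftE => [u|x|k x y].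
- exact: linear_funD (bl u).
- exact: linear_fun0 (bl x).
- by rewrite (linear_funZ _ _ (br x)) (linear_funZ _ _ (bl y)).
Qed.

Lemma eq_tlift b b' t :
  (forall v w, b v w = b' v w) -> tlift b t = tlift b' t.
Proof. by move=> bb'; apply: eq_bigr => i _; exact: bb'. Qed.

Lemma linear_tlift (U' : lmodType K) (f : U -> U') b t :
  linear f -> f (tlift b t) = tlift (fun v w => f (b v w)) t.
Proof. exact: linear_fun_sum. Qed.

End Lift.

Lemma tlift_exchange (V V' : vectType K) (W W' U : lmodType K)
    (f : V -> W -> V' -> W' -> U) s t :
  tlift (fun v w => tlift (f v w) t) s =
  tlift (fun v' w' => tlift (fun v w => f v w v' w') s) t.
Proof. exact: exchange_big. Qed.

(* f and g are arbitrary because they may be conjugate-linear. *)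
Lemma tlift_tmap (V V' : vectType K) (W W' U : lmodType K)
    (b : V' -> W' -> U) (f : V -> V') (g : W -> W') t :
  bilinear_map b ->
  tlift b (tmap f g t) = tlift (fun v w => b (f v) (g w)) t.
Proof.
move=> bb; rewrite /tmap linear_tlift; last exact: tlift_linear bb.2.
by apply: eq_tlift => v w; rewrite tlift_ptens.
Qed.

Lemma tlift_tmul (V : vectType K) (W U : lmodType K) (b : V -> W -> U)
    (m : V -> V -> V) (n : W -> W -> W) s t :
  bilinear_map b ->
  tlift b (tmul m n s t) =
  tlift (fun v w => tlift (fun v' w' => b (m v v') (n w w')) t) s.
Proof.
move=> bb; have bl := tlift_linear bb.2.
rewrite /tmul linear_tlift //; apply: eq_tlift => v w.
rewrite linear_tlift //; apply: eq_tlift => v' w'.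
by rewrite tlift_ptens.
Qed.

Lemma linear_idfun (V : lmodType K) : linear (fun x : V => x).
Proof. by []. Qed.

Lemma linear_funcomp (V V' U : lmodType K) (f : {linear V' -> U})
    (g : V -> V') :
  linear g -> linear (fun x => f (g x)).
Proof. by move=> gl k x y; rewrite gl linearP. Qed.

Lemma linear_mull (V : lmodType K) (A : algType K) (g : V -> A) c :
  linear g -> linear (fun x => g x * c).
Proof. by move=> gl k x y; rewrite gl mulrDl scalerAl. Qed.

Lemma linear_mulr (V : lmodType K) (A : algType K) (g : V -> A) c :
  linear g -> linear (fun x => c * g x).
Proof. by move=> gl k x y; rewrite gl mulrDr scalerAr. Qed.

Lemma bilinear_mul (A : algType K) : bilinear_map (@GRing.mul A).
Proof.
by split=> c; [exact: linear_mull|exact: linear_mulr].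
Qed.

Lemma linear_scalel (V U : lmodType K) (g : V -> K^o) (c : U) :
  linear g -> linear (fun x => g x *: c).
Proof. by move=> gl k x y; rewrite gl scalerDl scalerA. Qed.

Lemma linear_scaler (V U : lmodType K) (g : V -> U) (c : K) :
  linear g -> linear (fun x => c *: g x).
Proof. by move=> gl k x y; rewrite gl scalerDr !scalerA mulrC. Qed.

Lemma linear_tlift_param (V : vectType K) (W U U' : lmodType K)
    (b : U' -> V -> W -> U) t :
  (forall v w, linear (fun x => b x v w)) -> linear (fun x => tlift (b x) t).
Proof.
move=> bl k x y; rewrite /tlift scaler_sumr -big_split /=.
by apply: eq_bigr => i _; exact: bl.
Qed.

Lemma linear_tlift_arg (V : vectType K) (W U U' : lmodType K)
    (b : V -> W -> U) (g : U' -> tens V W) :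
  linear g -> (forall v, linear (b v)) -> linear (fun x => tlift b (g x)).
Proof. by move=> gl bl k x y; rewrite gl tlift_linear. Qed.

(** Rank-nullity: the image is the whole space, so the kernel has dimension zero. *)
Lemma linear_surj_inj (V : vectType K) (f g : V -> V) :
  linear f -> cancel g f -> injective f.
Proof.
move=> fl gK; pose F : {linear V -> V} :=
  HB.pack f (GRing.isLinear.Build K V V *:%R f fl).
have FE x : linfun F x = f x by rewrite lfunE.
suff /lker0P Finj : lker (linfun F) == 0%VS.
  by move=> x y; rewrite -!FE; exact: Finj.
rewrite -dimv_eq0 -(eqn_add2r (\dim (linfun F @: fullv))) add0n.
rewrite -{1}[lker _](capfv) limg_ker_dim; apply/eqP; congr (\dim _).
apply/esym/vspaceP => x; rewrite memvf; apply/memv_imgP.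
by exists (g x); rewrite ?memvf // FE gK.
Qed.

End TensorCalculus.

(** Descends through an expression towards the variable in question, one layer per lemma. A bundled
    linear map applied on the outside is peeled off last. *)
Ltac prove_linear :=
  lazymatch goal with
  | |- bilinear_map _ => split => ?; prove_linear
  | |- trilinear_map _ => split => ? ?; prove_linear
  | |- forall _, _ => move=> ?; prove_linear
  | _ => first
    [ done
    | exact: linear_idfun
    | assumption
    | apply linear_mull; prove_linear
    | apply linear_mulr; prove_linear
    | apply linear_scalel; prove_linear
    | apply linear_scaler; prove_linear
    | apply linear_tlift_param; prove_linear
    | apply linear_tlift_arg; prove_linear
    | apply linear_funcomp; prove_linear ]
  end.

(** * Sweedler identities, strong invariance and nondegeneracy of the Haar form *)

Section Hopf.
Variables (K : numClosedFieldType) (G : finQuantumGroup K).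
Implicit Types a b c : G.

(** A sum [tlift f (Delta a)] is read as f(a_1, a_2). Both sides here are the values of one map on
    the two sides of [Delta_coassoc]. *)
Lemma sweedler_coassoc (U : lmodType K) (f : G -> G -> G -> U) a :
  trilinear_map f ->
  tlift (fun u w => tlift (fun u' u'' => f u' u'' w) (Delta u)) (Delta a) =
  tlift (fun u w => tlift (fun w' w'' => f u w' w'') (Delta w)) (Delta a).
Proof.
move=> [f1 f2 f3].
(* The map induced by f on the right-nested triple tensor product. *)
pose F := tlift (fun u (t : tens G G) => tlift (f u) t).
have bF : bilinear_map (fun u (t : tens G G) => tlift (f u) t).
  split=> [t|u]; last exact: tlift_linear.
  by apply linear_tlift_param => v w; exact: f1.
have bf u : bilinear_map (f u) by split=> *; [exact: f2|exact: f3].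
transitivity (F (tassoc (tmap Delta id (Delta a)))).
- rewrite /F /tassoc linear_tlift; last exact: tlift_linear bF.2.
  have E (t : tens G G) (w : G) :
      F (tlift (fun u v => ptens u (ptens v w)) t) =
      tlift (fun u v => f u v w) t.
    rewrite /F linear_tlift; last exact: tlift_linear bF.2.
    by apply: eq_tlift => u v; rewrite !tlift_ptens.
  rewrite -/F tlift_tmap; first by apply: eq_tlift => u w; rewrite E.
  split=> [w|t] k x y; rewrite !E.
  + by apply: tlift_linear => v k' x' y'; exact: f2.
  + have /= -> // : linear (fun w => tlift (fun u v => f u v w) t).
    by apply linear_tlift_param => u v; exact: f3.
- by rewrite Delta_coassoc /F tlift_tmap.
Qed.

Lemma sweedler_antipodel (U : lmodType K) (f : G -> U) a :
  linear f ->
  tlift (fun u v => f (antipode u * v)) (Delta a) = counit a *: f 1.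
Proof.
move=> fl; rewrite -linear_tlift // -(linear_funZ _ _ fl); congr f.
by rewrite -antipodel tlift_tmap //; prove_linear.
Qed.

Lemma sweedler_antipoder (U : lmodType K) (f : G -> U) a :
  linear f ->
  tlift (fun u v => f (u * antipode v)) (Delta a) = counit a *: f 1.
Proof.
move=> fl; rewrite -linear_tlift // -(linear_funZ _ _ fl); congr f.
by rewrite -antipoder tlift_tmap //; prove_linear.
Qed.

Lemma sweedler_mul (U : lmodType K) (f : G -> G -> U) a b :
  bilinear_map f ->
  tlift f (Delta (a * b)) =
  tlift (fun u v => tlift (fun p q => f (u * p) (v * q)) (Delta b)) (Delta a).
Proof. by move=> fb; rewrite DeltaM tlift_tmul. Qed.

Lemma sweedler_counitl (U : lmodType K) (f : G -> U) a :
  linear f -> tlift (fun u v => counit u *: f v) (Delta a) = f a.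
Proof.
move=> fl; rewrite -[in RHS](counitl a) linear_tlift //.
by apply: eq_tlift => u v; rewrite (linear_funZ _ _ fl).
Qed.

Lemma sweedler_counitr (U : lmodType K) (f : G -> U) a :
  linear f -> tlift (fun u v => counit v *: f u) (Delta a) = f a.
Proof.
move=> fl; rewrite -[in RHS](counitr a) linear_tlift //.
by apply: eq_tlift => u v; rewrite (linear_funZ _ _ fl).
Qed.

(** Insert S(a_1) a_2 in front of b_1: h(a b_2) b_1 = h(a_3 b_2) S(a_1) a_2 b_1. Here a_2 b_1 and
    a_3 b_2 are the legs of the coproduct of a product, and invariance of h under id (x) h leaves
    h(a_2 b) S(a_1). *)
Lemma haar_strong_right a b :
  tlift (fun p q => haar (a * q) *: p) (Delta b) =
  tlift (fun u v => haar (v * b) *: antipode u) (Delta a).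
Proof.
transitivity (tlift (fun p q => tlift (fun u w =>
    tlift (fun u' u'' => haar (w * q) *: (antipode u' * u'' * p)) (Delta u))
  (Delta a)) (Delta b)).
  apply: eq_tlift => p q.
  transitivity (tlift (fun u w => counit u *: (haar (w * q) *: p)) (Delta a)).
    rewrite (@sweedler_counitl _ (fun w => haar (w * q) *: p)) //.
    by prove_linear.
  apply: eq_tlift => u w.
  rewrite (@sweedler_antipodel _ (fun x => haar (w * q) *: (x * p))) ?mul1r //.
  prove_linear.
transitivity (tlift (fun p q => tlift (fun u w =>
    tlift (fun v' v'' => haar (v'' * q) *: (antipode u * v' * p)) (Delta w))
  (Delta a)) (Delta b)).
  apply: eq_tlift => p q.
  rewrite (@sweedler_coassoc _
    (fun u v w => haar (w * q) *: (antipode u * v * p))) //.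
  prove_linear.
rewrite tlift_exchange; apply: eq_tlift => u w.
transitivity (tlift (fun x y => haar y *: (antipode u * x)) (Delta (w * b))).
  rewrite sweedler_mul; last by prove_linear.
  rewrite tlift_exchange; apply: eq_tlift => v' v''; apply: eq_tlift => p q.
  by rewrite mulrA.
rewrite -[RHS]mulr1 -scalerAl scalerAr -haarr /slicer.
rewrite (@linear_tlift _ _ _ _ _ (fun x => antipode u * x));
  last by prove_linear.
by apply: eq_tlift => p q; rewrite scalerAr.
Qed.

(** The mirror argument: insert b_2 S(b_3) after a_2, so that h(a_1 b) a_2 = h(a_1 b_1) a_2 b_2
    S(b_3), and use invariance under h (x) id. *)
Lemma haar_strong_left a b :
  tlift (fun u v => haar (u * b) *: v) (Delta a) =
  tlift (fun p q => haar (a * p) *: antipode q) (Delta b).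
Proof.
transitivity (tlift (fun u v => tlift (fun p q =>
    tlift (fun q' q'' => haar (u * p) *: (v * (q' * antipode q''))) (Delta q))
  (Delta b)) (Delta a)).
  apply: eq_tlift => u v.
  transitivity (tlift (fun p q => counit q *: (haar (u * p) *: v)) (Delta b)).
    rewrite (@sweedler_counitr _ (fun p => haar (u * p) *: v)) //.
    by prove_linear.
  apply: eq_tlift => p q.
  rewrite (@sweedler_antipoder _ (fun x => haar (u * p) *: (v * x))) ?mulr1 //.
  prove_linear.
transitivity (tlift (fun u v => tlift (fun p q =>
    tlift (fun p' p'' => haar (u * p') *: (v * (p'' * antipode q))) (Delta p))
  (Delta b)) (Delta a)).
  apply: eq_tlift => u v.
  rewrite (@sweedler_coassoc _
    (fun p q r => haar (u * p) *: (v * (q * antipode r)))) //.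
  prove_linear.
rewrite tlift_exchange; apply: eq_tlift => p q.
transitivity (tlift (fun x y => haar x *: (y * antipode q)) (Delta (a * p))).
  rewrite sweedler_mul; last by prove_linear.
  apply: eq_tlift => u v; apply: eq_tlift => p' p''.
  by rewrite mulrA.
rewrite -[RHS]mul1r -scalerAr scalerAl -haarl /slicel.
rewrite (@linear_tlift _ _ _ _ _ (fun x => x * antipode q));
  last by prove_linear.
by apply: eq_tlift => u v; rewrite scalerAl.
Qed.

Lemma antipode1 : antipode (1 : G) = 1.
Proof.
rewrite -[RHS]scale1r -[1 in RHS](counit1 G) -antipodel Delta1.
rewrite tlift_tmap; last by prove_linear.
by rewrite tlift_ptens ?mulr1 //; prove_linear.
Qed.

(* The null space of (a, b) |-> h(ab) is a left ideal and a left coideal, so it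
   contains S(b_1) b_2 = eps(b) 1; as h(1) = 1, it lies in the kernel of the
   counit, and a left coideal in the kernel of the counit is zero. *)
Lemma haar_mul_nondegenerate b : (forall a, haar (a * b) = 0) -> b = 0.
Proof.
(* Up to scalars this is a coordinate of h(a b'_2) b'_1, which strong invariance turns into h(a_2
   b') S(a_1) = 0. *)
have coideal b' k : (forall a, haar (a * b') = 0) ->
    forall a, haar (a * slicel (coord (vbasis fullv) k) (Delta b')) = 0.
  move=> Nb' a; rewrite /slicel.
  rewrite (@linear_tlift _ _ _ _ _ (fun x => haar (a * x)));
    last by prove_linear.
  transitivity (coord (vbasis fullv) k
    (tlift (fun p q => haar (a * q) *: p) (Delta b'))).
    rewrite linear_tlift; last by prove_linear.
    by apply: eq_tlift => p q; rewrite -scalerAr !linearZ /= mulrC.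
  rewrite haar_strong_right /tlift big1 ?linear0 // => i _.
  by rewrite Nb' scale0r.
have slices c : c = \sum_k coord (vbasis fullv) k c *: tbase k.
  exact: tbase_decomp.
have null_counit b' : (forall a, haar (a * b') = 0) -> counit b' = 0.
  move=> Nb'; transitivity (haar ((counit b')%:A : G)).
    by rewrite linearZ haar1 /= [RHS]mulr1.
  rewrite -antipodel tlift_tmap; last by prove_linear.
  transitivity (haar (\sum_k antipode (tbase k) *
      slicel (coord (vbasis fullv) k) (Delta b'))).
    apply: (congr1 haar); rewrite /slicel.
    under eq_bigr => k _ do
      (rewrite (@linear_tlift _ _ _ _ _ (fun x => antipode (tbase k) * x));
        last by prove_linear).
    rewrite exchange_big; apply: eq_bigr => i _ /=.
    rewrite [tbase i in LHS]slices linear_sum mulr_suml; apply: eq_bigr => k _.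
    by rewrite linearZ -scalerAl scalerAr.
  by rewrite linear_sum big1 // => k _; exact: coideal.
(* Expanding the first leg of Delta(b) in the basis, the coefficients of (id (x) eps)Delta(b) = b
   are counits of slices in the null space. *)
move=> Nb; rewrite -(counitr b) /slicer.
transitivity
  (\sum_k counit (slicel (coord (vbasis fullv) k) (Delta b)) *: tbase k).
  rewrite /slicel; under [RHS]eq_bigr => k _ do
    (rewrite linear_tlift; last by prove_linear).
  under [RHS]eq_bigr => k _ do rewrite /tlift scaler_suml.
  rewrite exchange_big; apply: eq_bigr => i _ /=.
  rewrite [tbase i in LHS]slices scaler_sumr; apply: eq_bigr => k _.
  by rewrite [in RHS]linearZ scalerA mulrC.
by rewrite big1 // => k _; rewrite null_counit ?scale0r // => a; exact: coideal.
Qed.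

(** Since h(a eta) = eps(a) h(eta), vanishing of h(eta) would put eta in the null space of the form,
    contradicting eps(eta) = 1. *)
Lemma haar_haarElt_neq0 : haar (haarElt G) != 0.
Proof.
apply/eqP => h0; have eta0 : haarElt G = 0.
  apply: haar_mul_nondegenerate => a.
  by rewrite mul_haarElt linearZ h0 /= [LHS]mulr0.
by have /eqP := counit_haarElt G; rewrite eta0 linear0 eq_sym oner_eq0.
Qed.

(** By strong invariance, h(a eta_1) S(eta_2) = h(a_1 eta) a_2 = eps(a_1) h(eta) a_2. The formula
    exhibits a as a value of S and recovers it from the functional h(a .). *)
Lemma haarElt_antipode a :
  haar (haarElt G) *: a =
  antipode (tlift (fun p q => haar (a * p) *: q) (Delta (haarElt G))).
Proof.
rewrite linear_tlift; last by prove_linear.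
rewrite (@eq_tlift _ _ _ _ _ (fun p q => haar (a * p) *: antipode q));
  last first.
  by move=> p q; rewrite linearZ.
rewrite -haar_strong_left -[a in LHS]counitl /slicel.
rewrite linear_tlift; last by prove_linear.
by apply: eq_tlift => u v; rewrite mul_haarElt [in RHS]linearZ scalerA mulrC.
Qed.

Lemma antipode_inj : injective (antipode : G -> G).
Proof.
(* A right inverse of S, read off from [haarElt_antipode]; in finite dimension it makes S
   injective. *)
pose g a := (haar (haarElt G))^-1 *:
  tlift (fun p q => haar (a * p) *: q) (Delta (haarElt G)).
apply: (@linear_surj_inj _ _ _ g); first exact: linearP.
move=> a; rewrite /g linearZ -haarElt_antipode /= scalerA.
by rewrite mulVf ?scale1r // haar_haarElt_neq0.
Qed.

(** Nondegeneracy in the other variable: the right side of [haarElt_antipode] depends on a only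
    through h(a .). *)
Lemma haar_nondegenerate a : (forall x, haar (a * x) = 0) -> a = 0.
Proof.
move=> Na; apply: (scalerI haar_haarElt_neq0); rewrite haarElt_antipode scaler0.
rewrite /tlift big1 ?linear0 // => i _; by rewrite Na scale0r.
Qed.

(** * Convolution and its nondegeneracy *)

Lemma convolutionE a b :
  convolution a b = tlift (fun u v => haar (antipode u * a) *: v) (Delta b).
Proof.
rewrite /convolution /slicel tlift_tmul; last by prove_linear.
rewrite (@eq_tlift _ _ _ _ _ (fun u v => haar (u * a) *: v)); last first.
  move=> u v; rewrite tlift_ptens ?mulr1 //; prove_linear.
by rewrite tlift_tmap //; prove_linear.
Qed.

Lemma convolution_bilinear : bilinear_map (@convolution K G).
Proof.
split=> w k x y; rewrite !convolutionE.
  have l : linear (fun a => tlift (fun u v => haar (antipode u * a) *: v)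
    (Delta w)) by prove_linear.
  exact: l.
have l : linear (fun b => tlift (fun u v => haar (antipode u * w) *: v)
  (Delta b)) by prove_linear.
exact: l.
Qed.

(** With T = Delta(b) the sum is the convolution of a and b. A general T is allowed so that the
    lemma applies to a difference of two tensors. *)
Lemma convolution_nondegenerate (T : tens G G) :
  (forall a, tlift (fun u v => haar (antipode u * a) *: v) T = 0) -> T = 0.
Proof.
move=> T0.
(* The k-th coordinate of the hypothesis says h(S(T_k) x) = 0 for all x, where T_k is the k-th slice
   of the second leg. *)
have slice0 k : slicer (coord (vbasis fullv) k) T = 0.
  apply: antipode_inj; rewrite linear0; apply: haar_nondegenerate => x.
  have := congr1 (coord (vbasis (fullv : {vspace G})) k) (T0 x).
  rewrite linear0 /tlift linear_sum => <-.
  rewrite /slicer /tlift linear_sum mulr_suml linear_sum.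
  apply: eq_bigr => i _ /=.
  by rewrite !linearZ -scalerAl linearZ /= mulrC.
(* The k-th coordinate of [T i] is the i-th coordinate of the k-th slice. *)
apply/ffunP => i; rewrite ffunE [LHS]tbase_decomp big1 // => k _.
have := congr1 (coord (vbasis (fullv : {vspace G})) i) (slice0 k).
rewrite linear0 /slicer /tlift linear_sum (bigD1 i) //= big1 => [|j ji].
  by rewrite linearZ /= coord_tbase eqxx mulr1 addr0 => ->; rewrite scale0r.
by rewrite linearZ /= coord_tbase eq_sym (negPf ji) mulr0.
Qed.

End Hopf.

Lemma scaler_injl (K : fieldType) (V : lmodType K) (v : V) :
  v != 0 -> injective (fun k : K => k *: v).
Proof.
move=> v0 k l /eqP; rewrite -subr_eq0 -scalerBl scaler_eq0 (negPf v0) orbF.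
by rewrite subr_eq0 => /eqP.
Qed.

(** * Slicing a quantum family by a unital *-character of B *)

Section Slice.
Variables (K : numClosedFieldType) (G : finQuantumGroup K).
Variables (B : starAlgebra K) (alpha : {linear G -> tens G B}).
Hypothesis family : quantum_family_of_automorphisms alpha.
Variable chi : B -> K.
Hypothesis chi_linear : linear (chi : B -> K^o).
Hypothesis chi1 : chi (saone B) = 1.
Hypothesis chiM : forall b c, chi (samul b c) = chi b * chi c.
Hypothesis chi_star : forall b, chi (sastar b) = Num.conj (chi b).

Let psi a : G := slicer chi (alpha a).
Let chi_slice v w : G := chi w *: v.

Let chi_slice_bilinear : @bilinear_map K G B G chi_slice.
Proof.
split=> w; rewrite /chi_slice; first by prove_linear.
exact: (linear_scalel w chi_linear).
Qed.

Let psi_linear : linear psi.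
Proof.
apply linear_tlift_arg; first exact: linearP.
exact: chi_slice_bilinear.2.
Qed.

(** The operation m is left free in order to serve for both the product and the convolution. *)
Let slice_mul (m : G -> G -> G) (s t : tens G B) : bilinear_map m ->
  slicer chi (tmul m (@samul K B) s t) = m (slicer chi s) (slicer chi t).
Proof.
move=> mb; rewrite /slicer (tlift_tmul _ _ _ _ chi_slice_bilinear).
rewrite (linear_tlift _ _ (mb.1 _)); apply: eq_tlift => v w.
rewrite (linear_tlift _ _ (mb.2 _)); apply: eq_tlift => v' w'.
rewrite (linear_funZ _ _ (mb.2 _)) (linear_funZ _ _ (mb.1 _)).
by rewrite /chi_slice chiM scalerA mulrC.
Qed.

(** The conjugate-linear f stands for both [star] and [bullet]. *)
Let slice_star (f : G -> G) (t : tens G B) :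
    {morph f : a b / a + b} -> (forall k a, f (k *: a) = Num.conj k *: f a) ->
  slicer chi (tmap f (@sastar K B) t) = f (slicer chi t).
Proof.
move=> fD fZ; rewrite /slicer.
rewrite (@tlift_tmap K _ _ _ _ _ _ f (@sastar K B) _ chi_slice_bilinear) /tlift.
have f0 : f 0 = 0 by rewrite -[0 in LHS](scale0r (0 : G)) fZ rmorph0 scale0r.
rewrite (big_morph f fD f0); apply: eq_bigr => i _.
by rewrite /chi_slice chi_star fZ.
Qed.

Let slice_ptens (a : G) (b : B) : slicer chi (ptens a b) = chi b *: a.
Proof. exact: (tlift_ptens a b chi_slice_bilinear). Qed.

Let psi1 : psi 1 = 1.
Proof. by rewrite /psi (ush1 (qf_hom family)) slice_ptens chi1 scale1r. Qed.

Let psiM : {morph psi : a b / a * b}.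
Proof.
move=> a b; rewrite /psi (ushM (qf_hom family)) slice_mul //.
exact: bilinear_mul.
Qed.

Let psi_star : {morph psi : a / star a}.
Proof.
move=> a; rewrite /psi (ush_star (qf_hom family)) slice_star //.
  exact: starD.
exact: starZ.
Qed.

Let psi_surj a : exists a', psi a' = a.
Proof.
have [s /(congr1 (slicer chi))] := qf_podles family (ptens a (saone B)).
rewrite slice_ptens chi1 scale1r => ->.
(* Slicing the Podles decomposition of a (x) 1 replaces each factor 1 (x) p.2 by the scalar
   chi(p.2). *)
exists (\sum_(p <- s) chi p.2 *: p.1).
rewrite (big_morph psi (linear_funD psi_linear) (linear_fun0 psi_linear)).
have sl : linear (slicer chi : tens G B -> G).
  exact: tlift_linear chi_slice_bilinear.2.
rewrite (big_morph _ (linear_funD sl) (linear_fun0 sl)).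
apply: eq_bigr => p _; rewrite slice_mul; last exact: bilinear_mul.
by rewrite slice_ptens (linear_funZ _ _ psi_linear) -scalerAr mulr1.
Qed.

Let psi_bij : bijective psi.
Proof.
have /choice[g gK] : forall a, exists a', psi a' = a by exact: psi_surj.
exists g => //; apply: inj_can_sym => //.
exact: linear_surj_inj psi_linear gK.
Qed.

Let psi_conv a b : psi (convolution a b) = convolution (psi a) (psi b).
Proof.
by rewrite /psi (qf_conv family) slice_mul //; exact: convolution_bilinear.
Qed.

Let psi_haarElt : psi (haarElt G) = haarElt G.
Proof. by rewrite /psi (qf_haarElt family) slice_ptens chi1 scale1r. Qed.

Let haarElt_neq0 : haarElt G != 0.
Proof.
by apply: contra_neq (haar_haarElt_neq0 G) => ->; rewrite linear0.
Qed.

(** Compare the coefficients of eta in psi(a) eta = psi(a eta). *)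
Let psi_counit a : counit (psi a) = counit a.
Proof.
apply: (scaler_injl haarElt_neq0) => /=.
rewrite -!mul_haarElt -[in LHS]psi_haarElt.
by rewrite -psiM mul_haarElt (linear_funZ _ _ psi_linear) psi_haarElt.
Qed.

Let convolution1 (a : G) : convolution a 1 = haar a *: 1.
Proof.
rewrite convolutionE Delta1 tlift_ptens; last by prove_linear.
by rewrite antipode1 mul1r.
Qed.

(** Compare the coefficients of 1 after applying psi to the convolution of a with 1. *)
Let psi_haar (a : G) : haar (psi a) = haar a.
Proof.
apply: (scaler_injl (oner_neq0 G)) => /=.
rewrite -convolution1 -[in LHS]psi1 -psi_conv.
by rewrite convolution1 (linear_funZ _ _ psi_linear) psi1.
Qed.

Let psi_antipode (a : G) : antipode (psi a) = psi (antipode a).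
Proof.
(* S is [bullet] composed with [star], and psi commutes with both. *)
rewrite -(starK a) psi_star -/(bullet (psi (star a))) -/(bullet (star a)).
rewrite /psi -(qf_bullet family) slice_star //.
- by move=> x y; rewrite /bullet starD linearD.
- by move=> k x; rewrite /bullet starZ linearZ.
Qed.

Let psi_Delta (a : G) : Delta (psi a) = tmap psi psi (Delta a).
Proof.
apply/eqP; rewrite -subr_eq0; apply/eqP; apply: convolution_nondegenerate => c.
(* Only test elements psi(c') allow [psi_conv] and [psi_haar] to be applied. *)
have [c' <-] := psi_surj c.
have cl : linear (tlift (fun u v : G => haar (antipode u * psi c') *: v)).
  by apply: tlift_linear; prove_linear.
(* The difference is put in the form k *: x + y, with k = -1, to use [cl]. *)
rewrite -[X in X - _]scale1r -scaleN1r addrC cl scaleN1r addrC scale1r.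
apply/eqP; rewrite subr_eq0; apply/eqP.
rewrite -convolutionE -psi_conv convolutionE tlift_tmap; last by prove_linear.
rewrite (linear_tlift _ _ psi_linear); apply: eq_tlift => u v.
by rewrite (linear_funZ _ _ psi_linear) psi_antipode -psiM psi_haar.
Qed.

Lemma slice_hopf_star_automorphism :
  hopf_star_automorphism (fun a => slicer chi (alpha a)).
Proof. by split. Qed.

End Slice.

(** * Classical groups: automorphisms of the function algebra *)

Section FunctionAlgebra.
Variables (K : numClosedFieldType) (gT : finType).

(** The indicators d_t sum to 1, so chi is nonzero on some d_t; applying chi to f d_t = f(t) d_t
    then gives the value at f. *)
Lemma ffun_character (chi : {ffun gT -> K} -> K) :
    {morph chi : f g / f + g} ->
    (forall f g : {ffun gT -> K}, chi [ffun s => f s * g s] = chi f * chi g) ->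
    (forall k : K, chi [ffun=> k] = k) ->
  exists t, forall f, chi f = f t.
Proof.
move=> chiD chiM chic.
pose d t : {ffun gT -> K} := [ffun s => (s == t)%:R].
have chi0 : chi 0 = 0.
  by rewrite -[RHS]chic; congr chi; apply/ffunP=> s; rewrite !ffunE.
have [t dt] : exists t, chi (d t) != 0.
  apply/existsP; rewrite -[X in is_true X]negbK negb_exists.
  apply/negP => /forallP d0.
  have /eqP := chic 1; rewrite (_ : [ffun=> 1] = \sum_t d t); last first.
    apply/ffunP => s; rewrite ffunE sum_ffunE (bigD1 s) //= big1 => [|t ts].
      by rewrite ffunE eqxx addr0.
    by rewrite ffunE eq_sym (negPf ts).
  rewrite (big_morph chi chiD chi0) big1 => [|t _]; last exact/eqP/negbNE.
  by rewrite eq_sym oner_eq0.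
exists t => f; apply: (mulIf dt); rewrite -chiM -[in RHS](chic (f t)) -chiM.
congr chi; apply/ffunP => s; rewrite !ffunE.
by case: eqVneq => [->|_]; rewrite ?mulr0.
Qed.

End FunctionAlgebra.

Lemma function_algebra_automorphism (K : numClosedFieldType)
    (G : finQuantumGroup K) (gT : finGroupType) (theta : G -> {ffun gT -> K})
    (psi : G -> G) :
  function_algebra_iso theta -> hopf_star_automorphism psi ->
  exists2 phi : {perm gT}, phi \in Aut [set: gT]%G &
    forall (a : G) (s : gT), theta (psi a) s = theta a (phi s).
Proof.
move=> Ht Hp; have [th' thK th'K] := fa_bij Ht.
have theta_inj := can_inj thK.
have thD a b s : theta (a + b) s = theta a s + theta b s.
  by rewrite -[a]scale1r (fa_linear Ht) scale1r mul1r.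
have th0 s : theta 0 s = 0.
  by apply: (addIr (theta 0 s)); rewrite -thD !add0r.
have thZ k a s : theta (k *: a) s = k * theta a s.
  by rewrite -[k *: a]addr0 (fa_linear Ht) th0 addr0.
have [psi' psiK psi'K] := ha_bij Hp.
have pl := ha_linear Hp.
(* Transported along theta, the functional a |-> psi(a)(s) is a character, hence evaluation at the
   point taken as phi(s). *)
have /choice[phi phiE] s : exists t, forall a, theta (psi a) s = theta a t.
  have [|||t tE] := @ffun_character K gT (fun f => theta (psi (th' f)) s).
  - move=> f g; rewrite -thD -(linear_funD pl); congr (theta (psi _) s).
    by apply: theta_inj; apply/ffunP => t; rewrite thD !th'K ffunE.
  - move=> f g; rewrite -(faM Ht) -(haM Hp); congr (theta (psi _) s).
    by apply: theta_inj; apply/ffunP => t; rewrite (faM Ht) !th'K ffunE.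
  - move=> k; rewrite -[RHS]mulr1 -(fa1 Ht s) -thZ -(ha1 Hp).
    rewrite -(linear_funZ _ _ pl).
    congr (theta (psi _) s).
    apply: theta_inj; apply/ffunP => t.
    by rewrite thZ (fa1 Ht) th'K ffunE mulr1.
  by exists t => a; rewrite -tE thK.
(* Functions separate points, as the indicator of s shows. Injectivity of phi then follows from
   surjectivity of psi, and multiplicativity from compatibility with Delta. *)
have sep s t : (forall a, theta a s = theta a t) -> s = t.
  move=> st; have := st (th' [ffun u => (u == s)%:R]); rewrite th'K !ffunE eqxx.
  by case: eqVneq => // _ /eqP; rewrite oner_eq0.
have phi_inj : injective phi.
  move=> s t st; apply: sep => a.
  by rewrite -(psi'K a) !phiE st.
have th_bilinear s t :
    bilinear_map (fun b c : G => theta b s * theta c t : K^o).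
  split=> x k y z; rewrite thD thZ /=.
    by rewrite mulrDl -mulrA.
  by rewrite mulrDr mulrCA.
have phiM s t : phi (s * t)%g = (phi s * phi t)%g.
  apply: sep => a; rewrite -phiE -!(fa_Delta Ht) (ha_Delta Hp).
  rewrite (tlift_tmap _ _ _ (th_bilinear s t)).
  by apply: eq_tlift => u v; rewrite !phiE.
exists (perm phi_inj) => [|a s]; last by rewrite permE phiE.
rewrite inE; apply/andP; split.
  by apply/fintype.subsetP => x; rewrite !inE.
by apply/morphicP => x y _ _; rewrite !permE phiM.
Qed.

(** * Continuity in the parameter *)

Lemma cnorm_sum (K : numClosedFieldType) (G : finCstarAlgebra K) (I : finType)
    (F : I -> G) : cnorm (\sum_i F i) <= \sum_i cnorm (F i).
Proof.
apply: (big_ind2 (fun x y => cnorm x <= y)) => // [|x1 x2 y1 y2 h1 h2].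
  by rewrite -(scale0r (0 : G)) cnormZ normr0 mul0r.
exact: le_trans (cnormD _ _) (lerD h1 h2).
Qed.

Section Continuity.
Local Open Scope classical_set_scope.

Lemma slice_continuous (K : numClosedFieldType) (G : finQuantumGroup K)
    (X : topologicalType) (t : tens G (contAlgebra X K)) :
  cnorm_continuous (fun x => slicer (@evalAt X K x) t).
Proof.
move=> x0.
(* A majorant from the triangle inequality: t is a finite sum of e_i (x) t_i with each t_i
   continuous. *)
pose F (x : X) : K :=
  \sum_i `|evalAt x (t i) - evalAt x0 (t i)| * cnorm (tbase i : G).
have F0 : F x @[x --> x0] --> (0 : K).
  rewrite -[X in _ --> X](_ : \sum_(i < \dim (fullv : {vspace G}))
     0 * cnorm (tbase i : G) = 0);
    last by rewrite big1 // => i _; rewrite mul0r.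
  apply: cvg_big => [|i _]; first exact: add_continuous.
  apply: cvgMr_tmp.
  rewrite -[X in _ --> X](@normr0 K K).
  apply: cvg_norm.
  rewrite -(subrr (evalAt x0 (t i))).
  apply: cvgB; last exact: cvg_cst.
  exact: cts_fun.
apply/cvgrPdist_lt => e e0.
have /cvgrPdist_lt/(_ e e0) := F0.
apply: filterS => x; rewrite !sub0r !normrN => Fe.
apply: le_lt_trans Fe; rewrite !ger0_norm ?cnorm_ge0 //; last first.
  by apply: sumr_ge0 => i _; rewrite mulr_ge0 ?cnorm_ge0.
rewrite /slicer /tlift -sumrB; apply: le_trans (cnorm_sum _) _.
by apply: ler_sum => i _; rewrite -scalerBl cnormZ.
Qed.

End Continuity.

(** * Families over a compact space *)

Theorem proposition2p7 (R : realType) (G : finQuantumGroup R[i])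
    (X : topologicalType) (compactX : compact [set: X]%classic)
    (hausdorffX : hausdorff_space X)
    (alpha : {linear G -> tens G (contAlgebra X R[i])})
    (family : quantum_family_of_automorphisms alpha) :
  exists psi : X -> G -> G,
    [/\ forall x : X, hopf_star_automorphism (psi x),
        forall (x : X) (a : G), slicer (@evalAt X R[i] x) (alpha a) = psi x a,
        forall a : G, cnorm_continuous (fun x : X => psi x a) &
        forall (gT : finGroupType) (theta : G -> {ffun gT -> R[i]}),
          function_algebra_iso theta ->
          forall x : X, exists2 phi : {perm gT}, phi \in Aut [set: gT]%G &
            forall (a : G) (s : gT), theta (psi x a) s = theta a (phi s)].
Proof.
(* Evaluation at x is a unital *-character of C(X), because the operations there are pointwise. *)
have psiP x :
    hopf_star_automorphism (fun a => slicer (@evalAt X R[i] x) (alpha a)).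
  exact: slice_hopf_star_automorphism.
exists (fun x a => slicer (@evalAt X R[i] x) (alpha a)); split=> // [a|].
- exact: slice_continuous.
- by move=> gT theta thetaP x; exact: function_algebra_automorphism.
Qed.
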